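(* Let $\Lambda$ be a finite $k$-graph without sinks or sources such that the subgraphs $\{\Lambda_C:C\in\mathcal{C}\}$ are all coordinatewise irreducible. Suppose that $D\in\mathcal{C}$ is hereditary, and that $C\Lambda^{e_i}D\ne\emptyset$ for all $C\in\mathcal{C}$ and $1\le i\le k$. If there exists $j\in\{1,\dots,k\}$ such that $\rho(A_{C,j})<\rho(A_{D,j})$ for all $C\in\mathcal{C}\setminus\{D\}$, then $$\rho(A_{C,i})<\rho(A_{D,i})\quad\text{for all }C\in\mathcal{C}\setminus\{D\}\text{ and }1\le i\le k.$$
   Context: $\mathbb{N}=\{0,1,2,\dots\}$. A $k$-graph is a countable category $\Lambda$ with a functor $d:\Lambda\to\mathbb{N}^k$ such that whenever $d(\lambda)=m+n$ there are unique $\mu,\nu\in\Lambda$ with $d(\mu)=m$, $d(\nu)=n$, $\lambda=\mu\nu$. $\Lambda^n:=d^{-1}(n)$; $\Lambda^0$ (the vertices) is identified with the objects. The maps $s,r:\Lambda\to\Lambda^0$ are domain and codomain. For $V\subset\Lambda^0$, $E\subset\Lambda$: $VE=\{\lambda\in E:r(\lambda)\in V\}$, $EV=\{\lambda\in E:s(\lambda)\in V\}$, $vE=\{v\}E$, $Ev=E\{v\}$. $e_1,\dots,e_k$ are the generators of $\mathbb{N}^k$. $\Lambda$ is finite if every $\Lambda^n$ is finite; it has no sources (sinks) if $v\Lambda^n\ne\emptyset$ ($\Lambda^nv\neq\emptyset$) for all $v\in\Lambda^0$, $n\in\mathbb{N}^k$. The vertex matrix $A_i$ is the $\Lambda^0\times\Lambda^0$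 matrix $A_i(v,w)=|v\Lambda^{e_i}w|$; for $C\subset\Lambda^0$, $A_{C,i}$ is its $C\times C$ block; $\rho$ is the spectral radius. A square matrix $A$ is irreducible if for all $i,j$ there is $m\in\mathbb{N}$ with $A^m(i,j)\ne0$. Strongly connected components are the classes of the relation $v\sim w\iff v\Lambda w\neq\emptyset$ and $w\Lambda v\ne\emptyset$; a class $\{v\}$ with $v\Lambda v=\{v\}$ is trivial; $\mathcal{C}$ is the set of nontrivial strongly connected components. For $C\in\mathcal{C}$, $\Lambda_C:=C\Lambda C$ is a $k$-graph; it is coordinatewise irreducible if all $A_{C,i}$ ($1\le i\le k$) are irreducible. A set $H\subset\Lambda^0$ is hereditary if $v\in H$ and $v\Lambda w\ne\emptyset$ imply $w\in H$. *)

(* Defs.v *)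
From HB Require Import structures.
From mathcomp Require Import all_boot all_order all_algebra finmap.
From mathcomp Require Import all_classical all_reals.
From mathcomp Require Import complex.

Set Implicit Arguments.
Unset Strict Implicit.
Unset Printing Implicit Defensive.

Import Order.TTheory GRing.Theory Num.Theory.
Local Open Scope classical_set_scope.
Local Open Scope ring_scope.

(* [kcomp l m] is the composite of l after m when [src l = rng m]; its value on
   non-composable pairs is irrelevant, every axiom being guarded. *)
Record kgraph (k : nat) := KGraph {
  vertex : countType;
  mor : countType;
  rng : mor -> vertex;
  src : mor -> vertex;
  kid : vertex -> mor;
  kcomp : mor -> mor -> mor;
  deg : mor -> 'rV[nat]_k;
  rng_id : forall v, rng (kid v) = v;
  src_id : forall v, src (kid v) = v;
  rng_comp : forall l m, src l = rng m -> rng (kcomp l m) = rng l;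
  src_comp : forall l m, src l = rng m -> src (kcomp l m) = src m;
  comp_idl : forall l, kcomp (kid (rng l)) l = l;
  comp_idr : forall l, kcomp l (kid (src l)) = l;
  compA : forall l m n, src l = rng m -> src m = rng n ->
    kcomp l (kcomp m n) = kcomp (kcomp l m) n;
  deg_id : forall v, deg (kid v) = 0;
  deg_comp : forall l m, src l = rng m -> deg (kcomp l m) = deg l + deg m;
  factorization : forall l m n, deg l = m + n ->
    exists! p : mor * mor,
      [/\ src p.1 = rng p.2, deg p.1 = m, deg p.2 = n & l = kcomp p.1 p.2]
}.

Definition gen (k : nat) (i : 'I_k) : 'rV[nat]_k := delta_mx 0 i.

Section KGraphTheory.
Context (k : nat) (L : kgraph k).
Implicit Types (v w : vertex L) (V W C H : set (vertex L)).

(* $\Lambda^n$ *)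
Definition level (n : 'rV[nat]_k) : set (mor L) := [set l | deg l = n].

(* $V \Lambda W$ *)
Definition between V W : set (mor L) := [set l | V (rng l) /\ W (src l)].

Definition finite_kgraph := forall n, finite_set (level n).

Definition no_sources := forall v n, between [set v] setT `&` level n !=set0.

Definition no_sinks := forall v n, between setT [set v] `&` level n !=set0.

Definition strongly_connected v w :=
  between [set v] [set w] !=set0 /\ between [set w] [set v] !=set0.

Definition component C := exists v, C = [set w | strongly_connected v w].

Definition trivial_component C :=
  exists v, C = [set v] /\ between [set v] [set v] = [set kid v].

(* $\mathcal C$ *)
Definition nontrivial_components : set (set (vertex L)) :=
  [set C | component C /\ ~ trivial_component C].

Definition hereditary H :=
  forall v w, H v -> between [set v] [set w] !=set0 -> H w.

(* $A_i(v,w) = |v \Lambda^{e_i} w|$; [fset_set] is junk on infinite sets, so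
   this is meaningful when [finite_kgraph] holds. *)
Definition vertex_matrix (i : 'I_k) v w : nat :=
  #|` fset_set (between [set v] [set w] `&` level (gen i)) |.

(* $A_{C,i}$, for a finite set C, along the canonical enumeration of C. *)
Definition block C (i : 'I_k) : 'M[nat]_#|{: fset_set C}| :=
  \matrix_(a, b) vertex_matrix i (val (enum_val a)) (val (enum_val b)).

End KGraphTheory.

Arguments level {k} L n.
Arguments finite_kgraph {k} L.
Arguments no_sources {k} L.
Arguments no_sinks {k} L.
Arguments nontrivial_components {k} L.

Definition irreducible_mx (n : nat) (A : 'M[nat]_n) :=
  forall i j, exists m : nat, (A ^+ m) i j != 0.

Definition coordinatewise_irreducible (k : nat) (L : kgraph k)
    (C : set (vertex L)) :=
  forall i, irreducible_mx (block C i).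

Definition spectral_radius (R : realType) (n : nat) (A : 'M[R[i]]_n) : R :=
  sup [set complex.Re `|a| | a in [set a | eigenvalue A a]].

(* $\rho(A_{C,i})$ *)
Definition block_radius (R : realType) (k : nat) (L : kgraph k)
    (C : set (vertex L)) (i : 'I_k) : R :=
  spectral_radius (map_mx (fun n : nat => n%:R : R[i]) (block C i)).

(* Main.v *)
(** Write [rho i] for the radius of [A_{D,i}].  Since [D] is hereditary and every
    other component has radius below [rho j] for the matrix [A_j], the Perron
    vector of [A_{D,j}] extends uniquely to an eigenvector [g] of [A_j] on all
    vertices, with eigenvalue [rho j]; the extension is nonnegative.  The matrices
    [A_i] commute, so by uniqueness [A_i g = (rho i) g] for every [i].  Restricting
    to [C], [A_{C,i} g <= (rho i) g], strictly at a vertex of [C] that emits an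
    edge of degree [e_i] into [D]; pairing with the positive left Perron vector
    of [A_{C,i}] gives the strict inequality of radii. *)
Require Import Defs.
From mathcomp Require Import all_boot all_order all_algebra finmap.
From mathcomp Require Import all_classical all_reals topology normedtype derive.
From mathcomp Require Import complex.

Set Implicit Arguments.
Unset Strict Implicit.
Unset Printing Implicit Defensive.

Import Order.TTheory GRing.Theory Num.Theory.
Import numFieldNormedType.Exports.

Local Open Scope classical_set_scope.
Local Open Scope ring_scope.

(** * Perron-Frobenius theory of irreducible matrices *)

Definition nonneg_mx (R : numDomainType) m n (B : 'M[R]_(m, n)) :=
  forall a b, 0 <= B a b.

Definition pos_mx (R : numDomainType) m n (B : 'M[R]_(m, n)) :=
  forall a b, 0 < B a b.

Definition irreducible_nonneg_mx (R : numDomainType) n (B : 'M[R]_n) :=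
  nonneg_mx B /\ forall a b, exists m : nat, (B ^+ m) a b != 0.

Lemma pos_mx_nonneg (R : numDomainType) m n (B : 'M[R]_(m, n)) :
  pos_mx B -> nonneg_mx B.
Proof. by move=> B0 a b; exact: ltW. Qed.

Lemma nonneg_mulmx (R : numDomainType) m n p (A : 'M[R]_(m, n))
    (B : 'M[R]_(n, p)) :
  nonneg_mx A -> nonneg_mx B -> nonneg_mx (A *m B).
Proof. by move=> A0 B0 a b; rewrite mxE sumr_ge0// => c _; rewrite mulr_ge0. Qed.

Lemma nonneg_expmx (R : numDomainType) n (B : 'M[R]_n) m :
  nonneg_mx B -> nonneg_mx (B ^+ m).
Proof.
move=> B0; elim: m => [|m IH]; last by rewrite exprS; exact: nonneg_mulmx.
by move=> a b; rewrite mxE ler0n.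
Qed.

Lemma trmxX (R : comPzRingType) n (B : 'M[R]_n) m : (B ^+ m)^T = B^T ^+ m.
Proof.
elim: m => [|m IH]; first by rewrite !expr0 trmx1.
by rewrite exprS exprSr trmx_mul IH.
Qed.

Lemma irreducible_tr (R : realDomainType) n (B : 'M[R]_n) :
  irreducible_nonneg_mx B -> irreducible_nonneg_mx B^T.
Proof.
move=> [B0 irr]; split=> [a b|a b]; first by rewrite mxE.
by have [m Bm] := irr b a; exists m; rewrite -trmxX mxE.
Qed.

(** Each of the finitely many entries is nonzero in some power; [N] exceeds the largest exponent
    chosen, and the remaining terms are nonnegative. *)
Lemma irreducible_sum_pos (R : realDomainType) n (B : 'M[R]_n) :
  irreducible_nonneg_mx B ->
  exists N, pos_mx (\sum_(m < N) B ^+ m).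
Proof.
move=> [B0 irr].
have Bm a b : {m : nat | (B ^+ m) a b != 0}.
  by exists (xchoose (irr a b)); exact: (xchooseP (irr a b)).
exists (\max_a \max_b (projT1 (Bm a b))).+1 => a b.
rewrite summxE.
have lt_m : (projT1 (Bm a b) < (\max_a \max_b (projT1 (Bm a b))).+1)%N.
  rewrite ltnS.
  apply: (@leq_trans (\max_b projT1 (Bm a b))); last first.
    exact: (@leq_bigmax _ (fun a => \max_b projT1 (Bm a b)) a).
  exact: (@leq_bigmax _ (fun b => projT1 (Bm a b)) b).
rewrite (bigD1 (Ordinal lt_m))//= ltr_pwDl ?sumr_ge0//; last first.
  by move=> i _; exact: nonneg_expmx.
by rewrite lt0r nonneg_expmx// andbT; exact: (projT2 (Bm a b)).
Qed.

(* Maximise [r] over the pairs [(r, x)] with [x] in the simplex and [r x <= x B]: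
   if the inequality were strict somewhere at a maximiser, applying the positive
   matrix [\sum_m B ^+ m], which commutes with [B], would allow a larger [r]. *)
Lemma perron_row (R : realType) n (B : 'M[R]_n) : (0 < n)%N ->
  irreducible_nonneg_mx B ->
  exists r (x : 'rV[R]_n), pos_mx x /\ x *m B = r *: x.
Proof.
move=> n0 irr; have [B0 _] := irr.
have [N Q0] := irreducible_sum_pos irr; set Q := \sum_(m < N) _ in Q0.
have QB : Q *m B = B *m Q.
  rewrite mulmx_suml mulmx_sumr; apply: eq_bigr => m _.
  by rewrite -[LHS]exprSr -[RHS]exprS.
pose a0 := Ordinal n0.
(* Summing [r x <= x B] over the coordinates of a point of the simplex gives [r <= M], so the
   feasible set is bounded. *)
pose M := \sum_a \sum_b B a b.
pose K1 : set (R * 'rV[R]_n) :=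
  [set p : R * 'rV[R]_n | 0 <= p.1 <= M] `&`
  [set p : R * 'rV[R]_n | forall a, 0 <= p.2 0 a <= 1].
pose K2 : set (R * 'rV[R]_n) := [set p : R * 'rV[R]_n | \sum_a p.2 0 a = 1].
pose K3 : set (R * 'rV[R]_n) :=
  [set p : R * 'rV[R]_n | forall a, 0 <= (p.2 *m B) 0 a - p.1 * p.2 0 a].
have c1 : continuous (fun p : R * 'rV[R]_n => p.1) by move=> p; exact: cvg_fst.
have c2 a : continuous (fun p : R * 'rV[R]_n => p.2 0 a).
  move=> p; apply: (@continuous_comp _ _ _ snd (fun x : 'rV[R]_n => x 0 a)).
    exact: cvg_snd.
  exact: coord_continuous.
have cK1 : compact K1.
  have -> : K1 = `[0, M] `*` [set x : 'rV[R]_n | forall a, `[0, 1]%classic (x 0 a)].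
    apply/seteqP; split=> -[r x]; rewrite /K1 /=.
      move=> [rM x1]; split; first by rewrite /= in_itv.
      by move=> a; rewrite /= in_itv /=; exact: x1.
    move=> [rM x1]; split; first by rewrite in_itv in rM.
    by move=> a; have := x1 a; rewrite /= in_itv.
  apply: compact_setX; first exact: segment_compact.
  apply: (@rV_compact (R : ptopologicalType) n (fun=> `[0, 1]%classic)) => _.
  exact: segment_compact.
have clK2 : closed K2.
  apply: (@closed_comp _ _ (fun p : R * 'rV[R]_n => \sum_a p.2 0 a) [set 1]).
    by move=> p _; apply: (cvg_big add_continuous) => a _; exact: c2.
  exact: closed_eq.
have clK3 : closed K3.
  have -> : K3 = \bigcap_(a in [set: 'I_n])
    [set p : R * 'rV[R]_n | 0 <= (p.2 *m B) 0 a - p.1 * p.2 0 a].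
    by apply/seteqP; split=> p //=; [move=> h a _; exact: h|move=> h a; exact: h].
  apply: closed_bigI => a _.
  apply: (@closed_comp _ _
    (fun p : R * 'rV[R]_n => (p.2 *m B) 0 a - p.1 * p.2 0 a) [set x | 0 <= x]).
    move=> p _; apply: cvgB.
      under eq_fun do rewrite mxE.
      rewrite mxE; apply: (cvg_big add_continuous) => b _; apply: cvgM; first exact: c2.
      exact: cvg_cst.
    by apply: cvgM; [exact: c1|exact: c2].
  exact: closed_ge.
have cK : compact ((K1 `&` K2) `&` K3).
  by do 2?apply: compact_closedI.
(* Dividing by the coordinate sum makes a pair feasible; this provides both the starting point and,
   later, the competitor to the maximiser. *)
have normK r x : nonneg_mx x -> 0 < x 0 a0 ->
    (forall a, r * x 0 a <= (x *m B) 0 a) -> 0 <= r ->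
    ((K1 `&` K2) `&` K3) (r, (\sum_a x 0 a)^-1 *: x).
  move=> x0 xa0 rx r0.
  have s0 : 0 < \sum_a x 0 a.
    by rewrite (bigD1 a0)//= ltr_pwDl ?sumr_ge0.
  set s := \sum_a x 0 a in s0 *.
  have le1 a : s^-1 * x 0 a <= 1.
    by rewrite mulrC ler_pdivrMr// mul1r /s (bigD1 a)//= lerDl sumr_ge0.
  have sum1 : \sum_a (s^-1 *: x) 0 a = 1.
    by under eq_bigr do rewrite mxE; rewrite -mulr_sumr mulVf// gt_eqF.
  have k3 : K3 (r, s^-1 *: x).
    move=> a; rewrite /= -scalemxAl !mxE mulrCA -mulrBr mulr_ge0//.
      by rewrite invr_ge0 ltW.
    by have := rx a; rewrite mxE subr_ge0.
  split=> //; split=> //; split=> /=; last first.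
    by move=> a; rewrite mxE le1 mulr_ge0// invr_ge0 ltW.
  rewrite r0/= -[r]mulr1 -sum1 mulr_sumr.
  apply: (@le_trans _ _ (\sum_a ((s^-1 *: x) *m B) 0 a)).
    by apply: ler_sum => a _; have := k3 a; rewrite subr_ge0.
  under eq_bigr do rewrite mxE.
  rewrite exchange_big/=; apply: ler_sum => a _; apply: ler_sum => b _.
  by rewrite mxE -[leRHS]mul1r ler_wpM2r.
have [||c] := @compact_EVT_max _ R (fun p : R * 'rV[R]_n => p.1) _ _ cK.
- exists (0, (\sum_a (const_mx 1 : 'rV[R]_n) 0 a)^-1 *: const_mx 1).
  apply: normK => //; first by move=> a b; rewrite mxE.
    by rewrite mxE.
  move=> a; rewrite mul0r mxE sumr_ge0// => b _; rewrite mxE mul1r.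
  exact: B0.
- exact: continuous_subspaceT.
case: c => r x; rewrite inE => -[[[/= /andP[r0 rM] x01] x1] rx] max_r.
have x0 : nonneg_mx x by move=> i a; rewrite (ord1 i); case/andP: (x01 a).
have [a1 xa1] : exists a, 0 < x 0 a.
  apply/not_existsP => xn; have := x1; rewrite /K2/= big1 => [/esym/eqP|a _].
    by rewrite oner_eq0.
  by apply/eqP; rewrite eq_le x0 andbT leNgt; apply/negP/xn.
have pQ (y : 'rV[R]_n) a : nonneg_mx y -> 0 < y 0 a -> pos_mx (y *m Q).
  move=> y0 ya i b; rewrite (ord1 i) mxE (bigD1 a)//= ltr_pwDl ?mulr_gt0//.
  by apply: sumr_ge0 => c _; rewrite mulr_ge0// ltW.
have xQ := pQ _ _ x0 xa1.
(* The maximiser [x] may have zero entries; [x *m Q] has none, and it inherits the eigenvector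
   equation because [Q] commutes with [B]. *)
exists r, (x *m Q); split=> //.
pose d := x *m B - r *: x.
have d0 : nonneg_mx d.
  by move=> i a; rewrite (ord1 i) !mxE; have := rx a; rewrite mxE.
suff : d = 0.
  by move=> /subr0_eq xB; rewrite -mulmxA QB mulmxA xB -scalemxAl.
apply: contrapT => dn0.
have [a2 da2] : exists a, 0 < d 0 a.
  apply/not_existsP => dn; apply: dn0; apply/rowP => a; rewrite [RHS]mxE.
  by apply/eqP; rewrite eq_le d0 andbT leNgt; apply/negP/dn.
have dQ := pQ _ _ d0 da2.
(* The default [1] only keeps [e] positive; the minimum ensures [e (x Q) <= d Q] entrywise, whence
   [(r + e) (x Q) <= x Q B]. *)
pose e := \big[Num.min/1]_a ((d *m Q) 0 a / (x *m Q) 0 a).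
have e0 : 0 < e.
  by rewrite /e; elim/big_ind: _ => // [u v u0 v0|a _]; rewrite ?lt_min ?u0// divr_gt0.
have := max_r (r + e, (\sum_a (x *m Q) 0 a)^-1 *: (x *m Q)).
rewrite inE => /(_ _)/=; rewrite leNgt ltrDl e0/= => h.
suff : false by [].
apply: h; apply: normK => //; [exact: pos_mx_nonneg| |by rewrite addr_ge0// ltW].
move=> a.
have -> : x *m Q *m B = r *: (x *m Q) + d *m Q.
  by rewrite /d mulmxBl -scalemxAl -mulmxA QB mulmxA addrC subrK.
rewrite mulrDl [leRHS]mxE [X in _ <= X + _]mxE lerD2l -ler_pdivlMr//.
exact: bigmin_le.
Qed.

Definition real_radius (R : realType) n (B : 'M[R]_n) : R :=
  spectral_radius (map_mx (real_complex R) B).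

Lemma perron_col (R : realType) n (B : 'M[R]_n) : (0 < n)%N ->
  irreducible_nonneg_mx B ->
  exists r (x : 'cV[R]_n), pos_mx x /\ B *m x = r *: x.
Proof.
move=> n0 /irreducible_tr/(perron_row n0)[r [x [x0 xB]]].
exists r, x^T; split; first by move=> a b; rewrite mxE.
by rewrite -{1}[B]trmxK -trmx_mul xB linearZ.
Qed.

Lemma pairing_gt0 (R : realDomainType) n (l : 'rV[R]_n) (u : 'cV[R]_n) b :
  pos_mx l -> nonneg_mx u -> 0 < u b 0 -> 0 < (l *m u) 0 0.
Proof.
move=> l0 u0 ub; rewrite mxE (bigD1 b)//= ltr_pwDl ?mulr_gt0//.
by apply: sumr_ge0 => c _; rewrite mulr_ge0// ltW.
Qed.

Lemma le_pairing (R : realDomainType) n (l : 'rV[R]_n) (u w : 'cV[R]_n) :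
  nonneg_mx l -> (forall b, u b 0 <= w b 0) -> (l *m u) 0 0 <= (l *m w) 0 0.
Proof.
move=> l0 uw; rewrite !mxE; apply: ler_sum => b _; exact: ler_wpM2l.
Qed.

Lemma lt_pairing (R : realDomainType) n (l : 'rV[R]_n) (u w : 'cV[R]_n) b :
  pos_mx l -> (forall b, u b 0 <= w b 0) -> u b 0 < w b 0 ->
  (l *m u) 0 0 < (l *m w) 0 0.
Proof.
move=> l0 uw ltb; rewrite -subr_gt0.
have -> : (l *m w) 0 0 - (l *m u) 0 0 = (l *m (w - u)) 0 0.
  by rewrite mulmxBr [RHS]mxE [X in _ = _ + X]mxE.
apply: (pairing_gt0 (b := b)) => //.
  by move=> c i; rewrite (ord1 i) !mxE subr_ge0.
by rewrite !mxE subr_gt0.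
Qed.

(** Taking moduli in a left eigenvector equation [u B = a u] gives [|a| |u| <= |u| B] by the
    triangle inequality. Pairing with [x] turns this into a comparison of [|a|] with [r], since
    [|u| x] is positive. *)
Lemma eigenvalue_modulus_le (R : realType) n (B : 'M[R]_n) r (x : 'cV[R]_n) a :
  nonneg_mx B -> pos_mx x -> B *m x = r *: x ->
  eigenvalue (map_mx (real_complex R) B) a -> complex.Re `|a| <= r.
Proof.
move=> B0 x0 Bx /eigenvalueP[u uB un0].
have nK (z : R[i]) : `|z| = (complex.Re `|z|)%:C%C.
  by rewrite RRe_real// normr_real.
have Re0 (z : R[i]) : 0 <= complex.Re `|z|.
  by have := normr_ge0 z; rewrite {1}nK (ler0c _).
pose w : 'cV[R]_n := \col_b complex.Re `|u 0 b|.
have w0 : nonneg_mx w by move=> b i; rewrite mxE.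
have wB b : complex.Re `|a| * w b 0 <= (B^T *m w) b 0.
  rewrite -lecR rmorphM/= !mxE -!nK -normrM.
  have -> : a * u 0 b = (u *m map_mx (real_complex R) B) 0 b by rewrite uB mxE.
  rewrite mxE rmorph_sum/=; apply: le_trans (ler_norm_sum _ _ _) _.
  apply: ler_sum => c _; rewrite !mxE rmorphM/= -nK normrM mulrC.
  by rewrite [X in X * _]ger0_norm// ler0c.
have [b wb] : exists b, 0 < w b 0.
  apply/not_existsP => wn; move/eqP: un0; apply; apply/rowP => b.
  rewrite [RHS]mxE; apply/eqP; rewrite -normr_le0 nK lecR leNgt.
  by have /negP := wn b; rewrite mxE.
have xT0 : pos_mx x^T by move=> c i; rewrite mxE.
have xw := pairing_gt0 xT0 w0 wb.
rewrite -(ler_pM2r xw).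
have -> : r * (x^T *m w) 0 0 = (x^T *m (B^T *m w)) 0 0.
  by rewrite mulmxA -trmx_mul Bx linearZ/= -scalemxAl [RHS]mxE.
have -> : complex.Re `|a| * (x^T *m w) 0 0 = (x^T *m (complex.Re `|a| *: w)) 0 0.
  by rewrite -scalemxAr [RHS]mxE.
apply: le_pairing; first exact: pos_mx_nonneg.
by move=> c; rewrite [leLHS]mxE.
Qed.

(** Left and right positive eigenvectors have the same eigenvalue, as computing [l B x] in two ways
    shows. That value bounds the moduli of all eigenvalues and is itself one, so it is the
    radius. *)
Lemma perron (R : realType) n (B : 'M[R]_n) : (0 < n)%N ->
  irreducible_nonneg_mx B ->
  exists (l : 'rV[R]_n) (x : 'cV[R]_n),
    [/\ pos_mx l, pos_mx x, l *m B = real_radius B *: l &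
        B *m x = real_radius B *: x].
Proof.
move=> n0 irr; have [B0 _] := irr.
have [r [l [l0 lB]]] := perron_row n0 irr.
have [r' [x [x0 Bx]]] := perron_col n0 irr.
pose a0 := Ordinal n0.
have lx : 0 < (l *m x) 0 0.
  by apply: (pairing_gt0 (b := a0)) => //; exact: pos_mx_nonneg.
have rr' : r' = r.
  apply: (mulIf (lt0r_neq0 lx)).
  have : l *m (B *m x) = (l *m B) *m x by rewrite mulmxA.
  by rewrite lB Bx -scalemxAr -scalemxAl => /matrixP/(_ 0 0); rewrite !mxE.
subst r'.
have r0 : 0 <= r.
  have /matrixP/(_ 0 a0) := lB; rewrite [RHS]mxE => h.
  rewrite -(pmulr_lge0 _ (l0 0 a0)) -h; apply: nonneg_mulmx => //.
  exact: pos_mx_nonneg.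
suff -> : real_radius B = r by exists l, x.
have ubd : ubound [set complex.Re `|a| |
    a in [set a | eigenvalue (map_mx (real_complex R) B) a]] r.
  by move=> _ [a /= ea <-]; exact: eigenvalue_modulus_le ea.
have inS : [set complex.Re `|a| |
    a in [set a | eigenvalue (map_mx (real_complex R) B) a]] r.
  exists (r%:C%C); last by rewrite ger0_norm ?ler0c.
    rewrite /= (eigenvalue_map (real_complex R)); apply/eigenvalueP; exists l => //.
    by apply/eqP => /matrixP/(_ 0 a0); rewrite mxE; apply/eqP; rewrite gt_eqF.
rewrite /real_radius /spectral_radius; apply/eqP; rewrite eq_le; apply/andP; split.
  by apply: ge_sup => //; exists r.
by apply: ub_le_sup => //; exists r.
Qed.

(** Pairing with the positive left Perron vector [l] gives [c (l u) <= l B u], the radius times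
    [l u], and [l u] is positive. *)
Lemma subinvariant_radius_ge (R : realType) n (B : 'M[R]_n) c (u : 'cV[R]_n) b :
  irreducible_nonneg_mx B -> nonneg_mx u -> 0 < u b 0 ->
  (forall a, c * u a 0 <= (B *m u) a 0) -> c <= real_radius B.
Proof.
move=> irr u0 ub cu.
have [l [_ [l0 _ lB _]]] := perron (leq_ltn_trans (leq0n _) (ltn_ord b)) irr.
have lu := pairing_gt0 l0 u0 ub.
have : (l *m (c *: u)) 0 0 <= (l *m (B *m u)) 0 0.
  apply: le_pairing; first exact: pos_mx_nonneg.
  by move=> a; rewrite [leLHS]mxE.
by rewrite mulmxA lB -scalemxAr -scalemxAl mxE [leRHS]mxE ler_pM2r.
Qed.

(** The same pairing; strictness at the single index [b] survives because no entry of the left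
    Perron vector vanishes. *)
Lemma superinvariant_radius_lt (R : realType) n (B : 'M[R]_n) c
    (u : 'cV[R]_n) b :
  irreducible_nonneg_mx B -> nonneg_mx u ->
  (forall a, (B *m u) a 0 <= c * u a 0) -> (B *m u) b 0 < c * u b 0 ->
  real_radius B < c.
Proof.
move=> irr u0 cu ub.
have [l [_ [l0 _ lB _]]] := perron (leq_ltn_trans (leq0n _) (ltn_ord b)) irr.
have : (l *m (B *m u)) 0 0 < (l *m (c *: u)) 0 0.
  apply: (lt_pairing (b := b)) => //.
    by move=> a; rewrite [leRHS]mxE.
  by rewrite [ltRHS]mxE.
rewrite mulmxA lB -scalemxAr -scalemxAl mxE [ltRHS]mxE => h.
rewrite ltNge; apply/negP => rc; move: h; rewrite ltNge ler_wpM2r//.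
by apply: nonneg_mulmx => //; exact: pos_mx_nonneg.
Qed.

Lemma pos_eigenvector_radius (R : realType) n (B : 'M[R]_n) c (x : 'cV[R]_n) :
  (0 < n)%N -> irreducible_nonneg_mx B -> pos_mx x -> B *m x = c *: x ->
  c = real_radius B.
Proof.
move=> n0 irr x0 Bx; have [l [_ [l0 _ lB _]]] := perron n0 irr.
have lx : 0 < (l *m x) 0 0.
  by apply: (pairing_gt0 (b := Ordinal n0)) => //; exact: pos_mx_nonneg.
apply: (mulIf (lt0r_neq0 lx)).
have : l *m (B *m x) = (l *m B) *m x by rewrite mulmxA.
by rewrite lB Bx -scalemxAr -scalemxAl => /matrixP/(_ 0 0); rewrite !mxE.
Qed.

(** Subtracting from [w] the largest multiple of [x] that leaves a nonnegative vector [h] creates a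
    zero of [h] at some [a]. Reading [B ^+ m *m h = r ^+ m *: h] at [a], irreducibility spreads this
    zero to all indices. *)
Lemma eigenspace_pos_line (R : realFieldType) n (B : 'M[R]_n) r
    (x w : 'cV[R]_n) :
  irreducible_nonneg_mx B -> pos_mx x -> B *m x = r *: x -> B *m w = r *: w ->
  exists t, w = t *: x.
Proof.
(* The empty matrix is treated apart because the minimum below needs an index. *)
case: n B x w => [|n] B x w [B0 irr] x0 Bx Bw.
  by exists 0; apply/colP => -[].
pose a := [arg min_(a < ord0) (w a 0 / x a 0)]%O.
have min_a b : w a 0 / x a 0 <= w b 0 / x b 0.
  by rewrite /a; case: arg_minP => // i _; exact.
pose h := w - (w a 0 / x a 0) *: x.
have h0 : nonneg_mx h.
  by move=> b i; rewrite (ord1 i) !mxE subr_ge0 -ler_pdivlMr.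
have ha : h a 0 = 0 by rewrite !mxE divfK ?subrr// gt_eqF.
have Bh m : B ^+ m *m h = r ^+ m *: h.
  elim: m => [|m IH]; first by rewrite mul1mx scale1r.
  rewrite exprSr -mulmxA mulmxBr Bw -scalemxAr Bx scalerA mulrC -scalerA -scalerBr.
  by rewrite -scalemxAr IH scalerA -exprS.
exists (w a 0 / x a 0); apply/eqP; rewrite -subr_eq0 -/h; apply/eqP/colP => b.
have [m Bm] := irr a b.
have := congr1 (fun M : 'cV_n.+1 => M a 0) (Bh m).
rewrite [LHS]mxE [RHS]mxE ha mulr0 => /eqP; rewrite psumr_eq0.
  move=> /allP/(_ b)/(_ (mem_index_enum _)); rewrite /= mulf_eq0 (negPf Bm)/=.
  by move=> /eqP ->; rewrite mxE.
by move=> c _; rewrite mulr_ge0//; exact: nonneg_expmx.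
Qed.

(** * Vertex matrices and their blocks *)

Lemma big_fset_setI (T : choiceType) (S : Type) (idx : S)
    (op : Monoid.com_law idx) (A B : set T) (F : T -> S) : finite_set B ->
  \big[op/idx]_(x <- fset_set (A `&` B)) F x =
  \big[op/idx]_(x <- fset_set B | x \in A) F x.
Proof.
move=> finB; have finAB := finite_setIr A finB.
rewrite -[RHS]big_filter; apply: perm_big; apply: uniq_perm.
- exact: fset_uniq.
- by rewrite filter_uniq// fset_uniq.
by move=> x; rewrite mem_filter !in_fset_set// in_setI.
Qed.

Section FiniteGraph.
Context (k : nat) (L : kgraph k) (finL : finite_kgraph L).
Implicit Types (v w : vertex L) (C D : set (vertex L)) (i j : 'I_k).

(** Each vertex is the range of its identity morphism, and only finitely many morphisms have degree
    [0]. *)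
Lemma finite_vertices : finite_set [set: vertex L].
Proof.
apply: sub_finite_set (finite_image (@rng k L) (finL 0)) => v _.
by exists (kid v); [exact: deg_id|exact: rng_id].
Qed.

Lemma finite_vertex_set C : finite_set C.
Proof. exact: sub_finite_set finite_vertices. Qed.

Lemma vertex_matrix_sum i v w :
  vertex_matrix i v w =
  (\sum_(e <- fset_set (level L (gen i))) ((rng e == v) && (src e == w)))%N.
Proof.
rewrite /vertex_matrix -sum1_size big_fset_setI; last exact: finL.
rewrite big_mkcond/=; apply: eq_bigr => e _.
have -> : (e \in between [set v] [set w]) = (rng e == v) && (src e == w).
  apply/idP/idP; first by rewrite inE => -[/= -> ->]; rewrite !eqxx.
  by move=> /andP[/eqP ev /eqP ew]; rewrite inE.
by case: ifP.
Qed.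

(** Composition is a bijection from composable pairs of degrees [gen i] and [gen j] onto morphisms
    of degree [gen i + gen j]. Symmetry of this count in [i] and [j] is why the vertex matrices
    commute. *)
Lemma vertex_matrix_mul i j v w :
  (\sum_(u <- fset_set [set: vertex L]) vertex_matrix i v u * vertex_matrix j u w)%N =
  #|` fset_set (between [set v] [set w] `&` level L (gen i + gen j)) |.
Proof.
set Ei := fset_set (level L (gen i)); set Ej := fset_set (level L (gen j)).
pose P (p : mor L * mor L) :=
  [&& rng p.1 == v, src p.1 == rng p.2 & src p.2 == w].
have mem_level n e : (e \in fset_set (level L n)) = (deg e == n).
  rewrite in_fset_set; last exact: finL.
  by apply/idP/eqP; rewrite inE.
transitivity (\sum_(e <- Ei) \sum_(f <- Ej) P (e, f))%N.
  under eq_bigr do rewrite !vertex_matrix_sum big_distrl/=.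
  rewrite exchange_big/=; apply: eq_bigr => e _.
  under eq_bigr do rewrite big_distrr/=.
  rewrite exchange_big/=; apply: eq_bigr => f _.
  (* For a fixed pair of edges only the intermediate vertex [src e] contributes. *)
  rewrite (big_fsetD1 (src e))/=; last first.
    by rewrite in_fset_set ?in_setT//; exact: finite_vertices.
  rewrite big1_fset ?addn0; last first.
    by move=> u; rewrite in_fsetD1 eq_sym => /andP[/negPf -> _] _; rewrite andbF.
  by rewrite /P/= eqxx andbT [rng f == _]eq_sym; do 3?case: (_ == _).
pose s := [seq p <- [seq (e, f) | e <- Ei, f <- Ej] | P p].
have -> : (\sum_(e <- Ei) \sum_(f <- Ej) P (e, f))%N = size s.
  rewrite size_filter -sum1_count [RHS]big_mkcond/= big_allpairs.
  by apply: eq_bigr => e _; apply: eq_bigr => f _; case: (P _).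
have memS p : p \in s -> [/\ deg p.1 = gen i, deg p.2 = gen j, rng p.1 = v,
    src p.1 = rng p.2 & src p.2 = w].
  rewrite mem_filter => /andP[/and3P[/eqP p1 /eqP p2 /eqP p3]].
  move=> /allpairsP[[e f] /= [+ + pE]].
  by rewrite !mem_level pE /= in p1 p2 p3 * => /eqP-> /eqP->.
rewrite -(size_map (fun p : mor L * mor L => kcomp p.1 p.2)).
apply: perm_size; apply: uniq_perm.
(* Uniqueness of factorizations makes composition injective on [s]; their existence gives
   surjectivity below. *)
- rewrite map_inj_in_uniq.
    by rewrite filter_uniq// allpairs_uniq ?fset_uniq// => -[a b] [c d].
  move=> p q /memS[p1 p2 p3 p4 p5] /memS[q1 q2 q3 q4 q5] pq.
  have dpq : deg (kcomp p.1 p.2) = gen i + gen j by rewrite deg_comp// p1 p2.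
  have [r [_ uniq_r]] := factorization dpq.
  by rewrite -(uniq_r p) ?(uniq_r q)//; split.
- exact: fset_uniq.
move=> g; rewrite in_fset_set; last first.
  by apply: finite_setIr; exact: finL.
apply/mapP/idP.
  move=> [p /memS[p1 p2 p3 p4 p5] ->]; rewrite inE /=; split.
    by split; rewrite /= ?rng_comp ?src_comp.
  by rewrite /level /= deg_comp// p1 p2.
rewrite inE => -[[/= gv gw] gd].
have [p [[p1 p2 p3 p4] _]] := factorization gd.
exists p => //; rewrite mem_filter; apply/andP; split.
  apply/and3P; split; apply/eqP => //.
    by rewrite -gv p4 rng_comp.
  by rewrite -gw p4 src_comp.
by rewrite [p]surjective_pairing allpairs_f// mem_level ?p2 ?p3.
Qed.
End FiniteGraph.

(** * Real functions on the vertices and their restriction to blocks *)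

Section WeightedGraph.
Context (R : realType) (k : nat) (L : kgraph k) (finL : finite_kgraph L).
Implicit Types (v w : vertex L) (C D : set (vertex L)) (i j : 'I_k).
Implicit Types (g h : vertex L -> R).

Definition block_vertex C (a : 'I_#|{: fset_set C}|) : vertex L :=
  val (enum_val a).

Definition real_block C i : 'M[R]_#|{: fset_set C}| :=
  map_mx (fun n => n%:R) (block C i).

Definition restrict_block C g : 'cV[R]_#|{: fset_set C}| :=
  \col_a g (block_vertex a).

(** At most one term is nonzero, as [block_vertex] is injective; the sum avoids choosing a preimage
    of [v]. *)
Definition extend_by_zero C (x : 'cV[R]_#|{: fset_set C}|) v : R :=
  \sum_a x a 0 *+ (block_vertex a == v).

Definition vertex_op i g v : R :=
  \sum_(w <- fset_set [set: vertex L]) (vertex_matrix i v w)%:R * g w.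

Lemma block_vertex_in C (a : 'I_#|{: fset_set C}|) : C (block_vertex a).
Proof.
have := valP (enum_val a); rewrite in_fset_set; last exact: finite_vertex_set.
by rewrite inE.
Qed.

Lemma block_vertex_inj C : injective (@block_vertex C).
Proof. by move=> a b /val_inj/enum_val_inj. Qed.

Lemma block_vertex_onto C v : C v ->
  exists a : 'I_#|{: fset_set C}|, block_vertex a = v.
Proof.
move=> Cv; have vC : v \in fset_set C.
  by rewrite in_fset_set ?inE//; exact: finite_vertex_set.
by exists (enum_rank [` vC]%fset); rewrite /block_vertex enum_rankK.
Qed.

Lemma block_size_gt0 C v : C v -> (0 < #|{: fset_set C}|)%N.
Proof. by move=> /block_vertex_onto[a _]; exact: leq_ltn_trans (ltn_ord a). Qed.

Lemma sum_block C (F : vertex L -> R) :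
  \sum_(a < #|{: fset_set C}|) F (block_vertex a) =
  \sum_(w <- fset_set [set: vertex L] | w \in C) F w.
Proof.
rewrite -big_fset_setI; last exact: finite_vertices.
by rewrite setIT big_seq_fsetE/= -(big_enum_val (A := [pred x | true])
  (fun x : fset_set C => F (val x))).
Qed.

Lemma extend_block_vertex C (x : 'cV[R]_#|{: fset_set C}|) a :
  extend_by_zero x (block_vertex a) = x a 0.
Proof.
rewrite /extend_by_zero (bigD1 a)//= eqxx mulr1n big1 ?addr0// => b ba.
by rewrite (inj_eq (@block_vertex_inj C)) (negPf ba) mulr0n.
Qed.

Lemma restrict_extend C (x : 'cV[R]_#|{: fset_set C}|) :
  restrict_block C (extend_by_zero x) = x.
Proof. by apply/colP => a; rewrite mxE extend_block_vertex. Qed.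

Lemma extend_off C (x : 'cV[R]_#|{: fset_set C}|) v : ~ C v -> extend_by_zero x v = 0.
Proof.
move=> nCv; rewrite /extend_by_zero big1// => a _; case: eqP => // av.
by exfalso; apply: nCv; rewrite -av; exact: block_vertex_in.
Qed.

Lemma real_block_restrict C i g a :
  (real_block C i *m restrict_block C g) a 0 =
  \sum_(w <- fset_set [set: vertex L] | w \in C)
     (vertex_matrix i (block_vertex a) w)%:R * g w.
Proof.
rewrite -(sum_block C (fun w => (vertex_matrix i (block_vertex a) w)%:R * g w)).
by rewrite mxE; apply: eq_bigr => b _; rewrite !mxE.
Qed.

Lemma vertex_op_split C i g v :
  vertex_op i g v =
  \sum_(w <- fset_set [set: vertex L] | w \in C) (vertex_matrix i v w)%:R * g w +
  \sum_(w <- fset_set [set: vertex L] | w \notin C) (vertex_matrix i v w)%:R * g w.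
Proof. by rewrite /vertex_op (bigID (mem C)). Qed.

(** Terms outside [C] vanish, either because no edge leads there or because [g] is zero there. This
    covers hereditary sets as well as functions that vanish wherever edges leaving [C] end. *)
Lemma real_block_vertex_op C i g a :
  (forall w, ~ C w -> vertex_matrix i (block_vertex a) w != 0%N -> g w = 0) ->
  (real_block C i *m restrict_block C g) a 0 = vertex_op i g (@block_vertex C a).
Proof.
move=> gC; rewrite real_block_restrict (vertex_op_split C) [X in _ + X]big1 ?addr0//.
move=> w wC; have [->|A0] := eqVneq (vertex_matrix i (block_vertex a) w) 0%N.
  by rewrite mul0r.
by rewrite gC ?mulr0// => Cw; move/negP: wC; apply; rewrite inE.
Qed.

(** Both sides count morphisms of degree [gen i + gen j], weighted by [g] at their source. *)
Lemma vertex_op_comm i j g v :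
  vertex_op i (vertex_op j g) v = vertex_op j (vertex_op i g) v.
Proof.
have swap (i' j' : 'I_k) : vertex_op i' (vertex_op j' g) v =
    \sum_(w <- fset_set [set: vertex L])
      #|` fset_set (between [set v] [set w] `&` level L (gen i' + gen j')) |%:R * g w.
  under [LHS]eq_bigr do rewrite /vertex_op big_distrr/=.
  rewrite exchange_big/=; apply: eq_bigr => w _.
  rewrite -vertex_matrix_mul// natr_sum mulr_suml; apply: eq_bigr => u _.
  by rewrite natrM mulrA.
by rewrite !swap addrC.
Qed.

Lemma vertex_opB i g h v :
  vertex_op i (fun w => g w - h w) v = vertex_op i g v - vertex_op i h v.
Proof. by rewrite /vertex_op -sumrB; apply: eq_bigr => w _; rewrite mulrBr. Qed.

Lemma vertex_opZ i c g v : vertex_op i (fun w => c * g w) v = c * vertex_op i g v.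
Proof. by rewrite /vertex_op mulr_sumr; apply: eq_bigr => w _; rewrite mulrCA. Qed.

Lemma real_block_irreducible C i :
  irreducible_mx (block C i) -> irreducible_nonneg_mx (real_block C i).
Proof.
move=> irr; split=> [a b|a b]; first by rewrite mxE.
have [m Am] := irr a b; exists m.
have -> : real_block C i ^+ m = map_mx (fun n => n%:R) (block C i ^+ m).
  elim: m {Am} => [|m IH].
    by apply/matrixP => c d; rewrite !mxE; case: (_ == _).
  rewrite !exprS IH; apply/matrixP => c d; rewrite !mxE natr_sum.
  by apply: eq_bigr => e _; rewrite !mxE natrM.
by rewrite mxE pnatr_eq0.
Qed.

Lemma block_radiusE C i : block_radius R C i = real_radius (real_block C i).
Proof.
rewrite /block_radius /real_radius; congr spectral_radius.
by apply/matrixP => a b; rewrite !mxE rmorph_nat.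
Qed.

(** * Reachability and strongly connected components *)

Definition reaches v w := between [set v] [set w] !=set0.

Lemma reaches_refl v : reaches v v.
Proof. by exists (kid v); split=> /=; rewrite ?rng_id ?src_id. Qed.

Lemma reaches_trans v u w : reaches v u -> reaches u w -> reaches v w.
Proof.
move=> [e [/= ev eu]] [f [/= fu fw]]; exists (kcomp e f).
by split=> /=; rewrite ?rng_comp ?src_comp// eu fu.
Qed.

Lemma vertex_matrix_neq0 i v w : vertex_matrix i v w != 0%N <->
  between [set v] [set w] `&` level L (gen i) !=set0.
Proof.
have fin : finite_set (between [set v] [set w] `&` level L (gen i)).
  by apply: finite_setIr; exact: finL.
rewrite cardfs_eq0; split=> [|[e he]].
  by move=> /fset0Pn[e]; rewrite in_fset_set// inE; exists e.
by apply/fset0Pn; exists e; rewrite in_fset_set// inE.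
Qed.

Lemma vertex_matrix_reaches i v w : vertex_matrix i v w != 0%N -> reaches v w.
Proof. by move=> /vertex_matrix_neq0[e [vew _]]; exists e. Qed.

Lemma component_class C v : component C -> C v ->
  C = [set w | strongly_connected v w].
Proof.
move=> [u ->] [uv vu]; apply/seteqP; split=> w [] /= h1 h2.
  by split; [exact: reaches_trans h1|exact: reaches_trans uv].
by split; [exact: reaches_trans h1|exact: reaches_trans vu].
Qed.

(** A loop of degree [gen i] would have to be the identity at [v], whose degree is [0]. *)
Lemma trivial_component_matrix C v i : trivial_component C -> C v ->
  vertex_matrix i v v = 0%N.
Proof.
move=> [u [-> uu]] -> {v}.
apply/eqP; apply: contrapT => /negP nz; have /vertex_matrix_neq0 := nz.
rewrite uu => -[_ [-> /=]]; rewrite /level /= deg_id => /matrixP/(_ 0 i).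
by rewrite !mxE !eqxx.
Qed.

(* A subinvariant function lives on the components of large radius: look at a
   point of its support from which the fewest vertices can be reached. *)
Lemma subinvariant_eq0 D j c g :
  (forall C, nontrivial_components L C -> coordinatewise_irreducible C) ->
  (forall C, (nontrivial_components L `\ D) C ->
     real_radius (real_block C j) < c) -> 0 < c ->
  (forall v, 0 <= g v) -> (forall v, D v -> g v = 0) ->
  (forall v, ~ D v -> c * g v <= vertex_op j g v) -> forall v, g v = 0.
Proof.
move=> irr lt_c c0 g0 gD gc; apply: contrapT => /existsNP[v1 gv1].
pose reach v := fset_set [set w | reaches v w].
have reachE v w : (w \in reach v) = `[< reaches v w >].
  rewrite in_fset_set; last exact: finite_vertex_set.
  by apply/idP/asboolP; rewrite inE.
have ex : exists n, `[< exists v, g v <> 0 /\ #|` reach v| = n >].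
  by exists #|` reach v1|; apply/asboolP; exists v1.
case: (ex_minnP ex) => _ /asboolP[v [gv <-]] min_v {v1 gv1 ex}.
(* By minimality, a support point [w] reachable from [v] reaches no fewer vertices than [v], so both
   reach the same set, which contains [v]. *)
have back w : reaches v w -> g w <> 0 -> reaches w v.
  move=> vw gw; have sub : (reach w `<=` reach v)%fset.
    by apply/fsubsetP => u; rewrite !reachE => /asboolP wu; apply/asboolP;
      exact: reaches_trans wu.
  have : reach w == reach v.
    by rewrite eqEfcard sub min_v//; apply/asboolP; exists w.
  by move=> /eqP/fsetP/(_ v); rewrite !reachE => /asboolP; rewrite asboolT//;
    exact: reaches_refl.
pose C := [set w | strongly_connected v w].
have Cv : C v by split; exact: reaches_refl.
have nDv : ~ D v by move=> /gD.
(* Hence every edge of degree [gen j] that leaves the class of [v] ends at a zero of [g]. *)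
have gCv w : C w -> forall u, ~ C u -> vertex_matrix j w u != 0%N -> g u = 0.
  move=> [vw wv] u nCu /vertex_matrix_reaches wu; apply: contrapT => gu.
  have vu := reaches_trans vw wu.
  by apply: nCu; split=> //; exact: back.
have gv0 : 0 < g v by rewrite lt0r g0 andbT; apply/eqP.
have nD w : C w -> ~ D w \/ g w = 0.
  by move=> Cw; case: (pselect (D w)) => [/gD|]; [right|left].
have op0 w : 0 <= vertex_op j g w by apply: sumr_ge0 => u _; rewrite mulr_ge0.
(* In a trivial class there is no loop at [v], so [vertex_op j g v] is zero, against
   [0 < c * g v]. *)
have [trivC|nontrivC] := pselect (trivial_component C).
  have := gc _ nDv; rewrite leNgt => /negP; apply.
  rewrite /vertex_op big1 ?mulr_gt0// => u _.
  have [uC|nuC] := pselect (C u).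
    have -> : u = v by case: trivC uC Cv => s [-> _] /= -> ->.
    by rewrite (trivial_component_matrix _ trivC Cv) mul0r.
  have [->|A0] := eqVneq (vertex_matrix j v u) 0%N; first by rewrite mul0r.
  by rewrite (gCv v)// mulr0.
have Cnt : nontrivial_components L C by split=> //; exists v.
have CD : (nontrivial_components L `\ D) C.
  by split=> // CD; apply: nDv; rewrite -CD.
have [a av] := block_vertex_onto Cv.
(* In a nontrivial class, [g] restricts to a nonzero subinvariant vector of the block, which forces
   its radius up to at least [c]. *)
suff : c <= real_radius (real_block C j) by rewrite leNgt lt_c.
apply: (subinvariant_radius_ge (u := restrict_block C g) (b := a)).
- exact/real_block_irreducible/irr.
- by move=> b i; rewrite mxE.
- by rewrite mxE av.
move=> b; rewrite real_block_vertex_op; last first.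
  by apply: gCv; exact: block_vertex_in.
rewrite mxE; have [nDb|->] := nD _ (block_vertex_in b); first exact: gc.
by rewrite mulr0.
Qed.

End WeightedGraph.

(** * The common eigenfunction *)

Lemma mulmx_surj_of_inj (F : fieldType) n (M : 'M[F]_n) :
  (forall u : 'cV_n, M *m u = 0 -> u = 0) ->
  forall b : 'cV_n, exists z, M *m z = b.
Proof.
move=> inj b; have uM : M \in unitmx.
  rewrite -unitmx_tr -row_free_unit -kermx_eq0; apply/eqP/row_matrixP => i.
  rewrite row0; apply: trmx_inj; rewrite trmx0; apply: inj.
  by rewrite -{1}[M]trmxK -trmx_mul -row_mul mulmx_ker row0 trmx0.
by exists (invmx M *m b); rewrite mulKVmx.
Qed.

Section Domination.
Context (R : realType) (k : nat) (L : kgraph k) (finL : finite_kgraph L).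
Context (D : set (vertex L)).
Hypothesis irr :
  forall C, nontrivial_components L C -> coordinatewise_irreducible C.
Hypothesis ntD : nontrivial_components L D.
Hypothesis herD : hereditary D.
Variable j : 'I_k.
Hypothesis dom : forall C, (nontrivial_components L `\ D) C ->
  real_radius (real_block R C j) < real_radius (real_block R D j).
Hypothesis rD_gt0 : 0 < real_radius (real_block R D j).
Implicit Types (v w : vertex L) (C : set (vertex L)) (i : 'I_k).
Implicit Types (g h : vertex L -> R).
Local Notation rho i := (real_radius (real_block R D i)).

Lemma hereditary_block i g (a : 'I_#|{: fset_set D}|) :
  (real_block R D i *m restrict_block D g) a 0 = vertex_op i g (block_vertex a).
Proof.
apply: real_block_vertex_op => // w nDw A0; exfalso; apply: nDw.
exact: herD (block_vertex_in finL a) (vertex_matrix_reaches finL A0).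
Qed.

(** By the triangle inequality [|g|] is subinvariant off [D], so [subinvariant_eq0] applies. By
    linearity this is the uniqueness of an eigenfunction with prescribed values on [D]. *)
Lemma eigenfunction_off_eq0 g : (forall v, D v -> g v = 0) ->
  (forall v, ~ D v -> vertex_op j g v = rho j * g v) -> forall v, g v = 0.
Proof.
move=> gD gE v; apply/eqP; rewrite -normr_eq0; apply/eqP.
move: v; apply: (subinvariant_eq0 finL irr dom rD_gt0).
- by move=> v; exact: normr_ge0.
- by move=> v /gD ->; rewrite normr0.
move=> v nDv; rewrite -[rho j]gtr0_norm// -normrM -gE// /vertex_op.
apply: le_trans (ler_norm_sum _ _ _) _; apply: ler_sum => w _.
by rewrite normrM ger0_norm.
Qed.

(** A square linear system prescribes the values on [D] and the eigenvalue equation elsewhere. It is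
    injective by [eigenfunction_off_eq0], hence solvable; on [D] the equation follows from heredity
    and the hypothesis on [x]. *)
Lemma eigenfunction_extension (x : 'cV[R]_#|{: fset_set D}|) :
  real_block R D j *m x = rho j *: x ->
  exists g, restrict_block D g = x /\ forall v, vertex_op j g v = rho j * g v.
Proof.
move=> xE; pose V := [set: vertex L].
have bvK v : exists a : 'I_#|{: fset_set V}|, block_vertex a = v.
  exact: block_vertex_onto.
pose M : 'M[R]_#|{: fset_set V}| := \matrix_(a, b)
  if block_vertex a \in D then (a == b)%:R
  else (vertex_matrix j (block_vertex a) (block_vertex b))%:R - rho j *+ (a == b).
have ME u a : (M *m u) a 0 = if block_vertex a \in D then u a 0 else
    vertex_op j (extend_by_zero u) (block_vertex a) - rho j * u a 0.
  have diag (c : R) : \sum_b c *+ (a == b) * u b 0 = c * u a 0.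
    rewrite (bigD1 a)//= eqxx mulr1n big1 ?addr0// => b.
    by rewrite eq_sym => /negPf ->; rewrite mulr0n mul0r.
  rewrite mxE; under eq_bigr do rewrite mxE; case: ifP => aD.
    by rewrite diag mul1r.
  under eq_bigr do rewrite mulrBl; rewrite sumrB diag; congr (_ - _).
  rewrite -(@real_block_vertex_op R k L finL V j (extend_by_zero u) a); last first.
    by move=> w nVw; exfalso; apply: nVw.
  rewrite restrict_extend // mxE.
  by apply: eq_bigr => b _; rewrite !mxE.
have [|z zE] := mulmx_surj_of_inj _
    (\col_a (extend_by_zero x (block_vertex a)) : 'cV[R]_#|{: fset_set V}|) (M := M).
  move=> u Mu; suff u0 v : extend_by_zero u v = 0.
    by apply/colP => a; rewrite -extend_block_vertex u0 mxE.
  apply: eigenfunction_off_eq0 v => v; have [a <-] := bvK v => av.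
    by have := ME u a; rewrite Mu mxE mem_set// extend_block_vertex => <-.
  have := ME u a; rewrite Mu mxE memNset// extend_block_vertex => /esym/eqP.
  by rewrite subr_eq0 => /eqP.
have zD v : D v -> extend_by_zero z v = extend_by_zero x v.
  have [a <-] := bvK v => av; have := ME z a.
  by rewrite zE mxE mem_set// extend_block_vertex => <-.
have zx : restrict_block D (extend_by_zero z) = x.
  by apply/colP => a; rewrite mxE zD ?extend_block_vertex//; exact: block_vertex_in.
exists (extend_by_zero z); split=> // v.
have [Dv|nDv] := pselect (D v).
  have [a <-] := block_vertex_onto finL Dv.
  by rewrite -hereditary_block zx xE mxE -{1}zx mxE.
have [a av] := bvK v; have := ME z a.
rewrite zE mxE av memNset// extend_off// -av extend_block_vertex => /esym/eqP.
by rewrite subr_eq0 => /eqP.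
Qed.

Lemma D_size_gt0 : (0 < #|{: fset_set D}|)%N.
Proof.
have [[v ->] _] := ntD; apply: (@block_size_gt0 _ _ finL _ v).
by split; exact: reaches_refl.
Qed.

Lemma common_eigenfunction : exists g,
  [/\ forall v, 0 <= g v, forall v, D v -> 0 < g v &
      forall i v, vertex_op i g v = rho i * g v].
Proof.
have irrD i : irreducible_nonneg_mx (real_block R D i).
  exact/real_block_irreducible/irr.
have [_ [x [_ x0 _ xE]]] := perron D_size_gt0 (irrD j).
have [g [gx gE]] := eigenfunction_extension xE.
have gD v : D v -> 0 < g v.
  by move=> /(block_vertex_onto finL)[a <-]; have := x0 a 0; rewrite -gx mxE.
exists g; split; [|exact: gD|].
  (* The negative part [h] of [g] vanishes on [D] and is subinvariant, because [- g] and [0] are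
     both at most [h]; hence it is zero. *)
  pose h v := Num.max 0 (- g v).
  have hle v : h v = 0 -> 0 <= g v.
    by move=> h0; rewrite -oppr_le0 -h0 /h le_max lexx orbT.
  move=> v; apply: hle; move: v.
  apply: (subinvariant_eq0 finL irr dom rD_gt0).
  - by move=> v; rewrite /h le_max lexx.
  - by move=> v /gD gv; apply/max_idPl; rewrite oppr_le0 ltW.
  move=> v _; rewrite {1}/h; case: (leP 0 (- g v)) => _; last first.
    rewrite mulr0; apply: sumr_ge0 => w _.
    by rewrite mulr_ge0// /h le_max lexx.
  rewrite mulrN -gE /vertex_op -sumrN; apply: ler_sum => w _.
  by rewrite -mulrN ler_wpM2l// /h le_max lexx orbT.
move=> i v.
(* Here [h] is the defect in the eigenvalue equation for [i]. As the operators commute, it satisfies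
   the equation for [j], so it suffices that it vanishes on [D]. *)
pose h w := vertex_op i g w - rho i * g w.
suff : h v = 0 by move/eqP; rewrite subr_eq0 => /eqP.
have comm w : vertex_op j (vertex_op i g) w = rho j * vertex_op i g w.
  rewrite vertex_op_comm// -vertex_opZ; apply: eq_bigr => u _.
  by rewrite gE.
(* On [D], [vertex_op i g] is again in the [rho j]-eigenspace of the [j]-block, which is the line of
   [x]; positivity of [x] then identifies the factor as [rho i]. *)
have xi : exists t, restrict_block D (vertex_op i g) = t *: x.
  apply: eigenspace_pos_line (irrD j) x0 xE _.
  by apply/colP => a; rewrite hereditary_block comm !mxE.
have {xi} xiE : real_block R D i *m x = rho i *: x.
  have [t tE] := xi.
  have xt : real_block R D i *m x = t *: x.
    by rewrite -tE; apply/colP => a; rewrite -[X in _ *m X]gx hereditary_block mxE.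
  by rewrite xt -(pos_eigenvector_radius D_size_gt0 (irrD i) x0 xt).
move: v; apply: eigenfunction_off_eq0 => v.
  move=> /(block_vertex_onto finL)[a <-].
  rewrite /h -hereditary_block gx xiE mxE -{1}gx mxE.
  by rewrite subrr.
by move=> _; rewrite /h vertex_opB comm vertex_opZ gE [RHS]mulrBr [in RHS]mulrCA.
Qed.

End Domination.

(** * Comparison of the radii *)

Lemma radius_ge0 (R : realType) n (B : 'M[R]_n) :
  (0 < n)%N -> irreducible_nonneg_mx B -> 0 <= real_radius B.
Proof.
move=> n0 irr; have := subinvariant_radius_ge (c := 0) (u := const_mx 1)
  (b := Ordinal n0) irr; apply.
- by move=> a b; rewrite mxE.
- by rewrite mxE.
- by move=> a; rewrite mul0r mxE sumr_ge0// => b _; rewrite mxE mulr1 irr.1.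
Qed.

Theorem theorem4p2 (R : realType) (k : nat) (L : kgraph k)
    (D : set (vertex L)) :
  finite_kgraph L -> no_sinks L -> no_sources L ->
  (forall C, nontrivial_components L C -> coordinatewise_irreducible C) ->
  nontrivial_components L D ->
  hereditary D ->
  (forall C (i : 'I_k), nontrivial_components L C ->
     between C D `&` level L (gen i) !=set0) ->
  (exists j : 'I_k, forall C, (nontrivial_components L `\ D) C ->
     block_radius R C j < block_radius R D j) ->
  forall C (i : 'I_k), (nontrivial_components L `\ D) C ->
     block_radius R C i < block_radius R D i.
Proof.
move=> finL _ _ irr ntD herD toD [j dom] C i CD.
have {}dom C' : (nontrivial_components L `\ D) C' ->
    real_radius (real_block R C' j) < real_radius (real_block R D j).
  by move=> /dom; rewrite !block_radiusE.
have [ntC neqCD] := CD; have irrC i' := real_block_irreducible R (irr C ntC i').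
have compC := ntC.1.
have [e [[Ce De] ge]] := toD C i ntC.
have C0 := block_size_gt0 finL Ce.
(* The radius of the [j]-block of [D] is positive because it exceeds the nonnegative radius of the
   [j]-block of [C]. *)
have [g [g0 gD gE]] := common_eigenfunction finL irr ntD herD dom
  (le_lt_trans (radius_ge0 C0 (irrC j)) (dom C CD)).
(* Two components that share a vertex coincide. *)
have DnC w : D w -> ~ C w.
  move=> Dw Cw; apply: neqCD.
  by rewrite (component_class compC Cw) (component_class ntD.1 Dw).
have le_op v : \sum_(w <- fset_set [set: vertex L] | w \in C)
    (vertex_matrix i v w)%:R * g w <= vertex_op i g v.
  by rewrite (vertex_op_split C) lerDl sumr_ge0// => w _; rewrite mulr_ge0.
have [a aE] := block_vertex_onto finL Ce.
rewrite !block_radiusE.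
apply: (superinvariant_radius_lt (u := restrict_block C g) (b := a)) => //.
- by move=> b c; rewrite mxE.
- by move=> b; rewrite real_block_restrict// [leRHS]mulrC mxE mulrC -gE.
(* The strict gap at the range of [e] comes from the term of [src e], which lies in [D], hence
   outside [C], where [g] is positive. *)
rewrite real_block_restrict// mxE -gE (vertex_op_split C) ltrDl.
rewrite big_mkcond (big_fsetD1 (src e))/=; last first.
  by rewrite in_fset_set ?in_setT//; exact: finite_vertices.
rewrite memNset; last exact: DnC.
rewrite ltr_pwDl ?sumr_ge0// => [|w _]; last by case: ifP; rewrite ?mulr_ge0.
rewrite mulr_gt0 ?gD// ltr0n lt0n aE; apply/(vertex_matrix_neq0 finL).
by exists e.
Qed.
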